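(* Let $n\ge 3$ and let $X$ be a real $m\times n$ matrix whose rows $\mathbf x^{(1)},\dots,\mathbf x^{(m)}$ are regarded as points of $\mathbb{R}^n/\mathbb{R}\mathbf 1$, each with first coordinate $0$. Fix integers $2\le d_1<d_2\le n$ and let $t$ be the smallest entry of $X$. Let $P_{d_1,d_2}(X)$ be the $m\times n$ matrix whose $k$-th row is the point with first coordinate $0$, $d_1$-th coordinate $x^{(k)}_{d_1}$, $d_2$-th coordinate $x^{(k)}_{d_2}$, and all other coordinates equal to $t$. Let $\mathbf f=(0,f_2,\dots,f_n)$ be a tropical Fermat–Weber point of the rows of $P_{d_1,d_2}(X)$. Let $\mathbf r$ be the point with first coordinate $0$, $d_1$-th coordinate $r_{d_1}$, $d_2$-th coordinate $r_{d_2}$, and all other coordinates equal to $t$. If $r_{d_1}=f_{d_1}$ and $r_{d_2}=f_{d_2}$, then $\mathbf r$ is a tropical Fermat–Weber point of the rows of $P_{d_1,d_2}(X)$.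
   Context: $\mathbb{R}^n/\mathbb{R}\mathbf 1$ is $\mathbb R^n$ modulo adding multiples of $\mathbf 1=(1,\dots,1)$; points are represented with first coordinate $0$. Tropical distance: $d_{tr}(\mathbf u,\mathbf v)=\max_i(u_i-v_i)-\min_i(u_i-v_i)$. A tropical Fermat–Weber point of a finite list of points $\mathbf y^{(1)},\dots,\mathbf y^{(s)}$ (counted with multiplicity, e.g. the rows of a matrix) is any minimizer over $\mathbf y\in\mathbb{R}^n/\mathbb{R}\mathbf 1$ of $\sum_{i=1}^s d_{tr}(\mathbf y,\mathbf y^{(i)})$. *)

(* Defs.v *)
From HB Require Import structures.
From mathcomp Require Import all_boot all_order all_algebra.
From mathcomp Require Import generic_quotient ring_quotient.
From mathcomp Require Import reals.

Set Implicit Arguments.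
Unset Strict Implicit.
Unset Printing Implicit Defensive.

Import Order.TTheory GRing.Theory Num.Theory.

Local Open Scope ring_scope.
Local Open Scope quotient_scope.

Section TropicalTorus.
Variables (R : realType) (n : nat).

(* The line spanned by (1, ..., 1); membership is tested against the first
   coordinate so as to be a boolean. *)
Definition ones_line : {pred 'rV[R]_n.+1} := fun v => v == const_mx (v 0 0).

Lemma ones_lineP (v : 'rV[R]_n.+1) :
  reflect (exists c, v = const_mx c) (v \in ones_line).
Proof.
apply: (iffP eqP) => [->|[c ->]]; first by exists (v 0 0).
by rewrite mxE.
Qed.

Fact ones_line_zmod_closed : zmod_closed ones_line.
Proof.
split; first by apply/ones_lineP; exists 0; apply/rowP => i; rewrite !mxE.
move=> u v /ones_lineP[a ->] /ones_lineP[b ->].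
by apply/ones_lineP; exists (a - b); apply/rowP => i; rewrite !mxE.
Qed.
HB.instance Definition _ :=
  GRing.isZmodClosed.Build 'rV[R]_n.+1 ones_line ones_line_zmod_closed.

Definition trop_torus : Type := Quotient.quot ones_line.
HB.instance Definition _ := Quotient.on trop_torus.

Definition trop_point (v : 'rV[R]_n.+1) : trop_torus := \pi_trop_torus v.

Lemma trop_pointP (u v : 'rV[R]_n.+1) :
  trop_point u = trop_point v <-> exists c, u - v = const_mx c.
Proof.
have -> : (trop_point u = trop_point v) <-> (u - v \in ones_line).
  by rewrite (Quotient.idealrBE ones_line); split=> /eqP.
by split=> /ones_lineP.
Qed.

(* The base elements of the two big operators are entries of w, so these are
   the largest and the smallest entry of w. *)
Definition max_coord (w : 'rV[R]_n.+1) : R := \big[Num.max/w 0 0]_i w 0 i.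
Definition min_coord (w : 'rV[R]_n.+1) : R := \big[Num.min/w 0 0]_i w 0 i.
Definition spread (w : 'rV[R]_n.+1) : R := max_coord w - min_coord w.

Definition trop_dist (x y : trop_torus) : R := spread (repr x - repr y).

Lemma spread_shift (w : 'rV[R]_n.+1) (c : R) :
  spread (w + const_mx c) = spread w.
Proof.
have maxE : max_coord (w + const_mx c) = max_coord w + c.
  rewrite /max_coord !mxE; elim/big_ind2: _ => // [x a y b -> ->|i _].
    by rewrite addr_maxl.
  by rewrite !mxE.
have minE : min_coord (w + const_mx c) = min_coord w + c.
  rewrite /min_coord !mxE; elim/big_ind2: _ => // [x a y b -> ->|i _].
    by rewrite addr_minl.
  by rewrite !mxE.
by rewrite /spread maxE minE opprD addrACA subrr addr0.
Qed.

Lemma trop_distE (u v : 'rV[R]_n.+1) :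
  trop_dist (trop_point u) (trop_point v) = spread (u - v).
Proof.
have repr_pt w : exists c, repr (trop_point w) = w + const_mx c.
  have /trop_pointP[c cE] : trop_point (repr (trop_point w)) = trop_point w.
    by rewrite /trop_point reprK.
  by exists c; rewrite -cE addrC subrK.
rewrite /trop_dist; have [a ->] := repr_pt u; have [b ->] := repr_pt v.
rewrite -(spread_shift (u - v) (a - b)); congr spread.
by apply/rowP => i; rewrite !mxE opprD addrACA.
Qed.

(* A family indexed by 'I_s is a list of points with multiplicity. *)
Definition fermat_weber (s : nat) (Y : 'I_s -> trop_torus) (y : trop_torus) :=
  forall z, \sum_(i < s) trop_dist y (Y i) <= \sum_(i < s) trop_dist z (Y i).

Definition row_points (m : nat) (X : 'M[R]_(m, n.+1)) : 'I_m -> trop_torus :=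
  fun k => trop_point (row k X).

Definition smallest_entry (m : nat) (X : 'M[R]_(m, n.+1)) (t : R) :=
  (exists k j, X k j = t) /\ (forall k j, t <= X k j).

(* Coordinates are numbered from 0, so the first coordinate is 0 and the
   conditions 2 <= d1 < d2 <= n on coordinates 1, ..., n read 0 < d1 < d2. *)
Definition plane_point (d1 d2 : 'I_n.+1) (t a b : R) : 'rV[R]_n.+1 :=
  \row_j (if j == 0 then 0 else if j == d1 then a else if j == d2 then b else t).

Definition plane_projection (m : nat) (d1 d2 : 'I_n.+1) (t : R)
    (X : 'M[R]_(m, n.+1)) : 'M[R]_(m, n.+1) :=
  \matrix_(k < m) plane_point d1 d2 t (X k d1) (X k d2).

End TropicalTorus.

(* Main.v *)
(* The differences between r and a projected row are 0, f_d1 - a and f_d2 - b,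
   all of which occur among the differences between f and that row. So r is at
   most as far as f from every single row. *)

Require Import Defs.
From mathcomp Require Import all_boot all_order all_algebra.
From mathcomp Require Import reals.

Set Implicit Arguments.
Unset Strict Implicit.
Unset Printing Implicit Defensive.

Import Order.TTheory GRing.Theory Num.Theory.
Local Open Scope ring_scope.

Lemma max_coord_ge (R : realType) (n : nat) (w : 'rV[R]_n.+1) (i : 'I_n.+1) :
  w 0 i <= max_coord w.
Proof. exact: le_bigmax. Qed.

Lemma min_coord_le (R : realType) (n : nat) (w : 'rV[R]_n.+1) (i : 'I_n.+1) :
  min_coord w <= w 0 i.
Proof. exact: bigmin_le_cond. Qed.

(** The extremes of [v] occur among the entries of [w], hence lie between the extremes of [w];
    positions do not matter. *)
Lemma spread_le_of_entries (R : realType) (n : nat) (v w : 'rV[R]_n.+1) :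
  (forall i, exists j, v 0 i = w 0 j) -> spread v <= spread w.
Proof.
move=> vw; apply: lerB.
(* The bound is needed for every entry and also for the base element [v 0 0] of the big operator. *)
- have entry i : v 0 i <= max_coord w by have [j ->] := vw i; apply: max_coord_ge.
  exact: bigmax_le.
- have entry i : v 0 i >= min_coord w by have [j ->] := vw i; apply: min_coord_le.
  exact: le_bigmin.
Qed.

Lemma plane_point_entries (R : realType) (n : nat) (d1 d2 : 'I_n.+1)
    (t a b : R) (f : 'rV[R]_n.+1) :
    (0 < d1)%N -> (d1 < d2)%N -> f 0 0 = 0 ->
  forall i, exists j,
    (plane_point d1 d2 t (f 0 d1) (f 0 d2) - plane_point d1 d2 t a b) 0 i =
    (f - plane_point d1 d2 t a b) 0 j.
Proof.
move=> d1_gt0 d12 f0 i.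
have d1N0 : d1 != 0 by rewrite -val_eqE -lt0n.
have d2N0 : d2 != 0 by rewrite -val_eqE -lt0n (ltn_trans d1_gt0).
have d2N1 : d2 != d1 by rewrite -val_eqE gtn_eqF.
(* Away from [d1] and [d2] the two plane points agree, so the left side is 0; since [f 0 0 = 0],
   coordinate 0 supplies that value on the right. *)
exists (if i == d1 then d1 else if i == d2 then d2 else 0); rewrite !mxE.
have [->|iN1] := eqVneq i d1; first by rewrite (negPf d1N0) eqxx.
have [->|iN2] := eqVneq i d2.
  by rewrite (negPf d2N0) (negPf d2N1) eqxx.
(* The left side is [0 - 0] at the first coordinate and [t - t] elsewhere. *)
by rewrite eqxx f0; case: ifP => _; rewrite !subrr.
Qed.

Theorem theorem3p7 (R : realType) (m n : nat) (hn : (3 <= n.+1)%N)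
    (X : 'M[R]_(m, n.+1)) (hX : forall k, X k 0 = 0)
    (d1 d2 : 'I_n.+1) (hd1 : (0 < d1)%N) (hd12 : (d1 < d2)%N)
    (t : R) (ht : smallest_entry X t)
    (f : 'rV[R]_n.+1) (hf0 : f 0 0 = 0)
    (hf : fermat_weber (row_points (plane_projection d1 d2 t X))
            (trop_point f))
    (r1 r2 : R) (hr1 : r1 = f 0 d1) (hr2 : r2 = f 0 d2) :
  fermat_weber (row_points (plane_projection d1 d2 t X))
    (trop_point (plane_point d1 d2 t r1 r2)).
Proof.
(* As [f] is a minimizer, it is enough to compare with [f], one summand at a time. *)
move=> z; apply: le_trans (hf z); apply: ler_sum => k _.
(* Distances are now computed on the given vectors instead of the representatives chosen by the
   quotient, so the normalization of [f] applies. *)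
rewrite /row_points !trop_distE rowK hr1 hr2.
exact/spread_le_of_entries/plane_point_entries.
Qed.
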